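(* Let $I\subset\mathbb{R}$ be an interval and let $\gamma(s)=\alpha(s)+\varepsilon\beta(s)$, $s\in I$, be a smooth curve in $\mathbb{D}^2$ parametrized by equiaffine arc-length. Its equiaffine curvature $\kappa_\gamma$ vanishes identically if and only if, up to equiaffine transformations of $\mathbb{R}^2$, the real part is the parabola $\alpha(s)=\left(s,\frac{s^2}{2}\right)$ and the dual part is $$\beta(s)=\left(c_0s^2+c_1s,\; -\frac{c_1}{2}s^2+c_2s\right)+\beta_0,$$ for some constants $c_0,c_1,c_2\in\mathbb{R}$ and some constant vector $\beta_0\in\mathbb{R}^2$.
   Context: $\mathbb{D}=\{x+\varepsilon y: x,y\in\mathbb{R}\}$, with $\varepsilon^2=0$, $\varepsilon\ne 0$, is the commutative ring of dual numbers, and $\mathbb{D}^2$ is the free module of rank 2 over it. A smooth curve $\gamma:I\to\mathbb{D}^2$ of a real variable is written $\gamma=\alpha+\varepsilon\beta$ with $\alpha,\beta:I\to\mathbb{R}^2$ smooth (real and dual parts). For $u=(u_1,u_2),v=(v_1,v_2)$ in $\mathbb{R}^2$ or $\mathbb{D}^2$, $(u,v)=u_1v_2-u_2v_1$. The curve $\gamma$ is parametrized by equiaffine arc-length if $(\gamma'(s),\gamma''(s))=1$ for all $s\in I$; equivalently $(\alpha',\alpha'')=1$ and $(\alpha',\beta'')+(\beta',\alpha'')=0$ on $I$. The equiaffine curvature of $\gamma$ is $\kappa_\gamma=(\gamma'',\gamma'''):I\to\mathbb{D}$. An equiaffine transformation of $\mathbb{R}^2$ is a map $p\mapsto Ap+b$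 with $A$ a real $2\times2$ matrix, $\det A=1$, $b\in\mathbb{R}^2$. It acts on $\gamma=\alpha+\varepsilon\beta$ by $\gamma\mapsto (A\alpha+b)+\varepsilon A\beta$; ''up to equiaffine transformations of $\mathbb{R}^2$'' means after replacing $\gamma$ by its image under some such transformation. *)

(* Defs.v *)
From HB Require Import structures.
From mathcomp Require Import all_boot all_order all_algebra.
From mathcomp Require Import all_classical all_reals all_analysis.

Set Implicit Arguments.
Unset Strict Implicit.
Unset Printing Implicit Defensive.

Import Order.TTheory GRing.Theory Num.Theory.
Import numFieldNormedType.Exports.

Local Open Scope classical_set_scope.
Local Open Scope ring_scope.

(* The pair (x, y) encodes x + eps y.  The alias [dual] hides the componentwise
   product ring structure that the library puts on R * R. *)
Definition dual (R : Type) : Type := (R * R)%type.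

Definition re {R : Type} (z : dual R) : R := z.1.
Definition du {R : Type} (z : dual R) : R := z.2.

Section DualRing.
Variable R : comNzRingType.

HB.instance Definition _ := GRing.Zmodule.copy (dual R) (R * R)%type.

Definition dual_one : dual R := (1, 0).
Definition dual_mul (z w : dual R) : dual R :=
  (re z * re w, re z * du w + du z * re w).

Fact dual_mulA : associative dual_mul.
Proof.
move=> [a b] [c d] [e f].
by rewrite /dual_mul /re /du /= !mulrDr !mulrDl !mulrA addrA.
Qed.

Fact dual_mulC : commutative dual_mul.
Proof.
move=> [a b] [c d]; rewrite /dual_mul /re /du /= (mulrC c a).
by rewrite (mulrC c b) (mulrC d a) addrC.
Qed.

Fact dual_mul1 : left_id dual_one dual_mul.
Proof. by move=> [a b]; rewrite /dual_mul /re /du /= !mul1r mul0r addr0. Qed.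

Fact dual_mulDl : left_distributive dual_mul +%R.
Proof.
move=> [a b] [c d] [e f]; rewrite /dual_mul /re /du /= !mulrDl.
by congr (_, _); rewrite addrACA.
Qed.

Fact dual_one_neq0 : dual_one != 0.
Proof. by apply/eqP => -[/eqP]; rewrite oner_eq0. Qed.

HB.instance Definition _ := GRing.Zmodule_isComNzRing.Build (dual R)
  dual_mulA dual_mulC dual_mul1 dual_mulDl dual_one_neq0.

Definition eps : dual R := (0, 1).

Lemma eps_sqr : eps * eps = 0.
Proof. by congr (_, _); rewrite /= ?mul0r ?mulr0 ?addr0. Qed.

Lemma eps_neq0 : eps != 0.
Proof. by apply/eqP => -[/eqP]; rewrite oner_eq0. Qed.

Definition of_real (x : R) : dual R := (x, 0).

Lemma dualE (z : dual R) : z = of_real (re z) + eps * of_real (du z).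
Proof.
by case: z => x y; congr (_, _);
  rewrite /= ?mul0r ?mul1r ?addr0 ?add0r.
Qed.

End DualRing.

Definition bracket {K : comNzRingType} (u v : 'cV[K]_2) : K :=
  u 0 0 * v 1 0 - u 1 0 * v 0 0.

Definition pt {T : nzRingType} (x y : T) : 'cV[T]_2 :=
  \col_(i < 2) (if i == 0 then x else y).

Definition real_part {R : Type} (u : 'cV[dual R]_2) : 'cV[R]_2 := map_mx re u.
Definition dual_part {R : Type} (u : 'cV[dual R]_2) : 'cV[R]_2 := map_mx du u.
Definition dual_vec {R : Type} (a b : 'cV[R]_2) : 'cV[dual R]_2 :=
  map2_mx (fun x y => (x, y) : dual R) a b.

Section Derivative.
Variables (R : realType) (V : normedModType R) (I : set R).

(* Same difference quotient as [derivable] and [derive1], but only along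
   increments h staying in I; it is one-sided at an endpoint belonging to I. *)
Definition derivable_in (f : R -> V) (a : R) : Prop :=
  cvg ((fun h => h^-1 *: (f (h + a) - f a)) @ within [set h | I (h + a)] 0^').

Definition derive_in (f : R -> V) (a : R) : V :=
  lim ((fun h => h^-1 *: (f (h + a) - f a)) @ within [set h | I (h + a)] 0^').

Definition derive_in_n (n : nat) (f : R -> V) : R -> V := iter n derive_in f.

Definition smooth_in (f : R -> V) : Prop :=
  forall (n : nat) (s : R), I s -> derivable_in (derive_in_n n f) s.

Lemma derive_in_interior (f : R -> V) (a : R) :
  nbhs a I -> derive_in f a = derive1 f a.
Proof.
move=> Ia; rewrite /derive_in /derive1.
suff -> : within [set h | I (h + a)] 0^' = 0^' by [].
rewrite /within; apply/seteqP; split => P /=; last first.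
  by apply: filterS => h Ph _.
have Ih : \forall h \near nbhs (0 : R), I (h + a).
  have ha : (fun h : R => h + a) @ (0 : R) --> a.
    by rewrite -[X in _ --> X]add0r; apply: cvgD; [exact: cvg_id|exact: cvg_cst].
  exact: ha Ia.
by move=> H; near=> h; near: h; move: Ih H; apply: filterS2 => h Ih H h0; exact: H.
Unshelve. all: by end_near. Qed.

End Derivative.

Section DualCurves.
Variable R : realType.
Implicit Types (I : set R) (gamma : R -> 'cV[dual R]_2).

Definition smooth_curve I gamma : Prop :=
  smooth_in I (real_part \o gamma) /\ smooth_in I (dual_part \o gamma).

Definition curve_derive I (n : nat) gamma : R -> 'cV[dual R]_2 := fun s =>
  dual_vec (derive_in_n I n (real_part \o gamma) s)
           (derive_in_n I n (dual_part \o gamma) s).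

Definition equiaffine_arclength I gamma : Prop := forall s, I s ->
  bracket (curve_derive I 1 gamma s) (curve_derive I 2 gamma s) = 1.

Definition equiaffine_curvature I gamma : R -> dual R := fun s =>
  bracket (curve_derive I 2 gamma s) (curve_derive I 3 gamma s).

Definition affine_act (A : 'M[R]_2) (b : 'cV[R]_2) gamma : R -> 'cV[dual R]_2 :=
  fun s => dual_vec (A *m real_part (gamma s) + b) (A *m dual_part (gamma s)).

End DualCurves.

(* Main.v *)
Require Import Defs.
From mathcomp Require Import all_boot all_order all_algebra.
From mathcomp Require Import all_classical all_reals all_analysis.
From mathcomp Require Import ring lra.
Import Order.TTheory GRing.Theory Num.Theory.
Import numFieldNormedType.Exports.
Local Open Scope classical_set_scope.
Local Open Scope ring_scope.

(** Over the dual numbers the vectors [gamma'] and [gamma''] form a frame of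
    bracket 1, so a vector is determined by its brackets with both of them
    ([bracket_eq0]).  Differentiating [(gamma', gamma'') = 1] gives
    [(gamma', gamma''') = 0] ([bracket_derive13_eq0]), and the curvature is
    the other bracket [(gamma'', gamma''')].  Hence the curvature vanishes
    exactly when [gamma''' = 0], that is, when the real and dual parts are
    vector polynomials [v0 + s v1 + (s ^ 2 / 2) v2] on the interval.

    What remains is linear algebra.  If the real part has coefficients
    [a0, a1, a2] and the dual part [b0, b1, b2], arc-length parametrization says
    [(a1, a2) = 1] and [(a1, b2) + (b1, a2) = 0].  By the first equation the
    matrix sending [a1, a2] to the standard basis is unimodular
    ([frame_matrix]); together with a translation killing [a0] it turns the
    real part into the parabola.  It sends [b1] to [((b1, a2), (a1, b1))] and
    [b2] to [((b2, a2), (a1, b2))], and the second equation ties the second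
    coordinate of the latter to the first coordinate of the former: this is
    why the constant [c1] occurs twice in the normal form.

    On the analytic side, derivatives are limits of difference quotients along
    increments that stay in the interval, so they are one-sided at an endpoint.
    They are handled through a relation [has_derivative_in], for which the
    Leibniz rule for the bracket, the derivative of a quadratic, and the
    constancy of functions with zero derivative are established. *)

(** * Derivatives relative to an interval *)

Definition increments {R : realType} (I : set R) (a : R) : set_system R :=
  within [set h | I (h + a)] 0^'.

(** The relational form of [derive_in]: statements about a limit compose without
    first having to know that it exists. *)
Definition has_derivative_in {R : realType} {V : normedModType R} (I : set R)
    (f : R -> V) (a : R) (l : V) : Prop :=
  (fun h => h^-1 *: (f (h + a) - f a)) @ increments I a --> l.

Section RelativeDerivative.
Context {R : realType} {I : set R}.
Context (I_itv : is_interval I).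
Context (I_nondeg : exists a b : R, [/\ I a, I b & a < b]).

Local Instance increments_filter (a : R) : Filter (increments I a).
Proof. exact: within_filter. Qed.

Lemma near_increments (a : R) : \forall h \near increments I a, I (h + a) /\ h != 0.
Proof.
by rewrite near_withinE near_withinE; near=> h => h0 Ih.
Unshelve. all: by end_near. Qed.

Lemma increments_cvg0 (a : R) : h @[h --> increments I a] --> (0 : R).
Proof.
have h0 : within [set h | I (h + a)] 0^' `=>` 0^' by exact: cvg_within.
apply: cvg_trans h0 _; exact: cvg_within.
Qed.

(** Some [c] in [I] differs from [a], and by convexity [I] contains all points
    [a + t (c - a)] with [t] in [0, 1], hence points other than [a] as close to
    [a] as desired.  This makes the relative derivative unique. *)
Lemma increments_proper (a : R) : I a -> ProperFilter (increments I a).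
Proof.
move=> Ia; split; last exact: increments_filter.
rewrite /increments /within /= => -[e /= e0 He].
have [c Ic ca] : exists2 c, I c & c != a.
  case: I_nondeg => x [y [Ix Iy xy]]; case: (eqVneq x a) => [xa|xa].
    by exists y => //; rewrite -xa gt_eqF.
  by exists x.
have ca0 : c - a != 0 by rewrite subr_eq0.
have nca : 0 < `|c - a| by rewrite normr_gt0.
pose t := Num.min 1 (e / 2 / `|c - a|).
have t0 : 0 < t by rewrite lt_min ltr01 !divr_gt0.
have t1 : t <= 1 by rewrite ge_min lexx.
have te : t * `|c - a| < e.
  apply: (@le_lt_trans _ _ (e / 2)); last by lra.
  by rewrite -ler_pdivlMr // ge_min lexx orbT.
apply: (He (t * (c - a))) => /=.
- by rewrite sub0r normrN normrM (gtr0_norm t0).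
- by rewrite mulf_neq0 // gt_eqF.
- have [ac|ac] := ltP a c; [apply: (I_itv _ _ Ia Ic)|apply: (I_itv _ _ Ic Ia)]; nra.
Qed.

Lemma derive_inE {V : normedModType R} (f : R -> V) (a : R) (l : V) :
  I a -> has_derivative_in I f a l -> derive_in I f a = l.
Proof.
move=> Ia fl; have := increments_proper a Ia => Fa.
exact: (cvg_lim (@norm_hausdorff _ V) fl).
Qed.

Lemma eq_has_derivative_in {V : normedModType R} (f g : R -> V) (a : R) (l : V) :
  {in I, f =1 g} -> I a -> has_derivative_in I f a l -> has_derivative_in I g a l.
Proof.
move=> fg Ia; apply: cvg_trans; apply: near_eq_cvg.
near=> h; have [Ih _] : I (h + a) /\ h != 0 by near: h; exact: near_increments.
by rewrite !fg ?inE.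
Unshelve. all: by end_near. Qed.

Lemma has_derivative_in_cst {V : normedModType R} (v : V) (a : R) :
  has_derivative_in I (fun=> v) a 0.
Proof.
rewrite /has_derivative_in; under eq_fun do rewrite subrr scaler0.
exact: cvg_cst.
Qed.

Lemma has_derivative_in_cst_eq0 {V : normedModType R} (f : R -> V) (v : V)
    (a : R) (l : V) :
  (forall s, I s -> f s = v) -> I a -> has_derivative_in I f a l -> l = 0.
Proof.
move=> fv Ia fl; rewrite -(derive_inE _ _ _ Ia fl); apply: derive_inE => //.
apply: eq_has_derivative_in (has_derivative_in_cst v a) => // s.
by rewrite inE => /fv.
Qed.

Lemma has_derivative_inB {V : normedModType R} (f g : R -> V) (a : R) (l m : V) :
  has_derivative_in I f a l -> has_derivative_in I g a m ->
  has_derivative_in I (fun s => f s - g s) a (l - m).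
Proof.
move=> fl gm; apply: cvg_trans (cvgB fl gm); apply: near_eq_cvg.
near=> h => /=; rewrite -[LHS]/(_ *: _ - _ *: _) -scalerBr; congr (_ *: _).
by rewrite !opprB [RHS]addrACA [LHS]addrACA; congr (_ + _); rewrite addrC.
Unshelve. all: by end_near. Qed.

Lemma has_derivative_inD {V : normedModType R} (f g : R -> V) (a : R) (l m : V) :
  has_derivative_in I f a l -> has_derivative_in I g a m ->
  has_derivative_in I (fun s => f s + g s) a (l + m).
Proof.
move=> fl gm; apply: cvg_trans (cvgD fl gm); apply: near_eq_cvg.
near=> h => /=; rewrite -[LHS]/(_ *: _ + _ *: _) -scalerDr; congr (_ *: _).
by rewrite opprD addrACA.
Unshelve. all: by end_near. Qed.

Lemma has_derivative_in_cvg {V : normedModType R} (f : R -> V) (a : R) (l : V) :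
  has_derivative_in I f a l -> f (h + a) @[h --> increments I a] --> f a.
Proof.
move=> fl.
have : h *: (h^-1 *: (f (h + a) - f a)) + f a @[h --> increments I a] -->
    0 *: l + f a.
  by apply: cvgD; [apply: cvgZ fl; exact: increments_cvg0|exact: cvg_cst].
rewrite scale0r add0r; apply: cvg_trans; apply: near_eq_cvg.
near=> h; have [_ h0] : I (h + a) /\ h != 0 by near: h; exact: near_increments.
by rewrite scalerA divff // scale1r subrK.
Unshelve. all: by end_near. Qed.

(** Leibniz rule: the difference quotient of [(u, v)] at [a] equals
    [(quotient of u, v (a + h)) + (u a, quotient of v)], and [v (a + h)] tends
    to [v a]. *)
Lemma has_derivative_in_bracket (u v : R -> 'cV[R]_2) (a : R) (u' v' : 'cV[R]_2) :
  has_derivative_in I u a u' -> has_derivative_in I v a v' ->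
  has_derivative_in I (fun s => bracket (u s) (v s)) a
    (bracket u' (v a) + bracket (u a) v').
Proof.
move=> uu' vv'; have vc := has_derivative_in_cvg _ _ _ vv'.
have coord (F : set_system R) (FF : Filter F) (w : R -> 'cV[R]_2)
    (l : 'cV[R]_2) i : w @ F --> l -> w h i 0 @[h --> F] --> l i 0.
  by move=> wl; apply: (continuous_cvg FF (@coord_continuous _ _ _ i 0 l) wl).
have bracket_cvg (F : set_system R) (FF : Filter F) (w z : R -> 'cV[R]_2)
    (l m : 'cV[R]_2) : w @ F --> l -> z @ F --> m ->
    bracket (w h) (z h) @[h --> F] --> bracket l m.
  by move=> wl zm; apply: cvgB; apply: cvgM; exact: coord.
have := cvgD (bracket_cvg _ _ _ _ _ _ uu' vc)
  (bracket_cvg _ _ _ _ _ _ (cvg_cst (u a)) vv').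
move=> /(_ _ _ _ _).
apply: cvg_trans; apply: near_eq_cvg; near=> h => /=.
by rewrite -[LHS]/(bracket _ _ + bracket _ _) /bracket !mxE /GRing.scale /=; ring.
Unshelve. all: by end_near. Qed.

Lemma has_derivative_in_continuous (f f' : R -> R) :
  (forall a, I a -> has_derivative_in I f a (f' a)) -> {within I, continuous f}.
Proof.
move=> ff'; apply/subspace_continuousP => a Ia U /= Ufa.
have := has_derivative_in_cvg _ _ _ (ff' a Ia) _ Ufa.
rewrite /increments /= nbhs_simpl /= => /nbhs_ballP[e /= e0 He].
apply/nbhs_ballP; exists e => //= t aet It.
have [->|ta] := eqVneq t a; first exact: nbhs_singleton.
have := He (t - a); rewrite /= subrK; apply => //.
- by move: aet; rewrite /ball /= sub0r normrN distrC.
- by rewrite subr_eq0.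
Qed.

(** At an interior point the constraint on the increments is void near 0, which
    gives access to the mean value theorem for two-sided derivatives. *)
Lemma has_derivative_in_is_derive (f : R -> R) (a l : R) :
  nbhs a I -> has_derivative_in I f a l -> is_derive a 1 f l.
Proof.
move=> Ia fl.
have Ih : \forall h \near (0 : R)^', I (h + a).
  apply: cvg_within; have ha : (fun h : R => h + a) @ (0 : R) --> a.
    by rewrite -[X in _ --> X]add0r; apply: cvgD; [exact: cvg_id|exact: cvg_cst].
  exact: ha Ia.
have fl1 : (fun h => h^-1 *: (f (h *: (1 : R) + a) - f a)) @ 0^' --> l.
  move=> U /fl; rewrite /increments /within /=; apply: filterS2 Ih => h Ih Uh.
  by rewrite /= [h *: _]mulr1; exact: Uh.
split; first by apply/cvg_ex; exists l.
exact: (cvg_lim (@norm_hausdorff _ _) fl1).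
Qed.

(** The mean value theorem on the segment from [x] to [y]: inside, the relative
    derivative is an ordinary one; at the ends only relative continuity is
    needed. *)
Lemma has_derivative_in0_cst (f : R -> R) :
  (forall a, I a -> has_derivative_in I f a 0) ->
  forall x y, I x -> I y -> f x = f y.
Proof.
move=> f0.
suff lt_case x y : I x -> I y -> x < y -> f x = f y.
  move=> x y Ix Iy; have [xy|yx|->//] := ltgtP x y; first exact: lt_case.
  by apply/esym; exact: lt_case.
move=> Ix Iy xy.
have sub : `[x, y] `<=` I by move=> z /=; rewrite in_itv /=; exact: I_itv.
have [||c _] := @MVT R f (fun=> 0) x y xy.
- move=> z zxy; apply: has_derivative_in_is_derive; last first.
    by apply/f0/sub/subset_itv_oo_cc.
  have : nbhs z `]x, y[%classic.
    by apply: open_nbhs_nbhs; split => //; exact: interval_open.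
  by apply: filterS => t /subset_itv_oo_cc; exact: sub.
- exact: continuous_subspaceW sub (has_derivative_in_continuous _ _ f0).
- by rewrite mul0r => /eqP; rewrite subr_eq0 => /eqP.
Qed.

Lemma has_derivative_in0_cst_vec (n : nat) (f : R -> 'cV[R]_n) :
  (forall a, I a -> has_derivative_in I f a 0) ->
  forall x y, I x -> I y -> f x = f y.
Proof.
move=> f0 x y Ix Iy; apply/colP => i.
apply: (has_derivative_in0_cst (fun s => f s i 0)) => // a Ia.
have : (fun M : 'cV[R]_n => M i 0) (h^-1 *: (f (h + a) - f a))
    @[h --> increments I a] --> (0 : 'cV[R]_n) i 0.
  exact: (continuous_cvg _ (@coord_continuous _ _ _ i 0 (0 : 'cV[R]_n)) (f0 a Ia)).
rewrite mxE; apply: cvg_trans; apply: near_eq_cvg.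
by near=> h; rewrite !mxE.
Unshelve. all: by end_near. Qed.

(** * Curves with vanishing third derivative *)

(** With the factor [1 / 2], differentiation merely shifts the coefficients. *)
Definition quadratic {V : normedModType R} (v0 v1 v2 : V) (s : R) : V :=
  v0 + s *: v1 + (s ^+ 2 / 2) *: v2.

Lemma has_derivative_in_quadratic {V : normedModType R} (v0 v1 v2 : V) (a : R) :
  has_derivative_in I (quadratic v0 v1 v2) a (quadratic v1 v2 0 a).
Proof.
have : v1 + (a + h / 2) *: v2 @[h --> increments I a] --> v1 + (a + 0 / 2) *: v2.
  apply: cvgD; first exact: cvg_cst.
  apply: cvgZr_tmp; apply: cvgD; first exact: cvg_cst.
  by apply: cvgM; [exact: increments_cvg0|exact: cvg_cst].
rewrite mul0r addr0 /quadratic scaler0 addr0; apply: cvg_trans; apply: near_eq_cvg.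
near=> h; have [_ h0] : I (h + a) /\ h != 0 by near: h; exact: near_increments.
rewrite -[v0 + _ + _]addrA -[v0 + _ + _]addrA opprD addrACA subrr add0r.
rewrite opprD addrACA -2!scalerBl scalerDr !scalerA addrK mulVf //.
by rewrite scale1r; congr (_ + _ *: _); field.
Unshelve. all: by end_near. Qed.

Lemma smooth_in_has_derivative {V : normedModType R} (f : R -> V) (n : nat) (a : R) :
  smooth_in I f -> I a ->
  has_derivative_in I (derive_in_n I n f) a (derive_in_n I n.+1 f a).
Proof. by move=> sf Ia; exact: sf. Qed.

Lemma derive_in_n_quadratic {V : normedModType R} (f : R -> V) (v0 v1 v2 : V) :
  {in I, f =1 quadratic v0 v1 v2} ->
  [/\ {in I, derive_in_n I 1 f =1 quadratic v1 v2 0},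
      {in I, derive_in_n I 2 f =1 quadratic v2 0 0} &
      {in I, derive_in_n I 3 f =1 fun=> 0}].
Proof.
have step (g : R -> V) w0 w1 w2 : {in I, g =1 quadratic w0 w1 w2} ->
    {in I, derive_in I g =1 quadratic w1 w2 0}.
  move=> gq a; rewrite inE => Ia; apply: derive_inE => //.
  apply: eq_has_derivative_in (has_derivative_in_quadratic w0 w1 w2 a) => //.
  by move=> s /gq.
move=> fq; have f1 := step _ _ _ _ fq; have f2 := step _ _ _ _ f1.
split=> // a Ia; rewrite [LHS](step _ _ _ _ f2 _ Ia) /quadratic.
by rewrite !scaler0 !addr0.
Qed.

(** Integrates three times: if [g' = quadratic w1 w2 0] then
    [g - quadratic 0 w1 w2] has zero derivative, hence is a constant [w0]. *)
Lemma quadratic_of_derive_in3 (n : nat) (f : R -> 'cV[R]_n) :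
  smooth_in I f -> (forall s, I s -> derive_in_n I 3 f s = 0) ->
  exists v0 v1 v2 : 'cV[R]_n, {in I, f =1 quadratic v0 v1 v2}.
Proof.
move=> sf f3; have [x0 [_ [Ix0 _ _]]] := I_nondeg.
have step (g g' : R -> 'cV[R]_n) w1 w2 :
    (forall a, I a -> has_derivative_in I g a (g' a)) ->
    {in I, g' =1 quadratic w1 w2 0} -> exists w0, {in I, g =1 quadratic w0 w1 w2}.
  move=> gg' g'q; exists (g x0 - quadratic 0 w1 w2 x0) => s; rewrite inE => Is.
  have := has_derivative_in0_cst_vec n (fun s => g s - quadratic 0 w1 w2 s)
    _ _ _ Is Ix0.
  move=> <- => [|a Ia].
    by rewrite /quadratic add0r -addrA subrK.
  have := has_derivative_inB _ _ _ _ _ (gg' a Ia)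
    (has_derivative_in_quadratic 0 w1 w2 a).
  by rewrite g'q ?inE // subrr.
have [v2 h2] : exists v2, {in I, derive_in_n I 2 f =1 quadratic v2 0 0}.
  apply: (step _ (derive_in_n I 3 f)) => [a Ia|s].
    exact: smooth_in_has_derivative.
  by rewrite inE /quadratic !scaler0 !addr0 => /f3.
have [v1 h1] : exists v1, {in I, derive_in_n I 1 f =1 quadratic v1 v2 0}.
  by apply: (step _ (derive_in_n I 2 f)) => // a Ia; exact: smooth_in_has_derivative.
have [v0 h0] : exists v0, {in I, f =1 quadratic v0 v1 v2}.
  apply: (step _ (derive_in_n I 1 f)) => // a Ia.
  exact: (smooth_in_has_derivative _ 0).
by exists v0, v1, v2.
Qed.

End RelativeDerivative.

(** * Brackets and frames *)

Lemma eq_col2 {T : Type} (u v : 'cV[T]_2) : u 0 0 = v 0 0 -> u 1 0 = v 1 0 -> u = v.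
Proof.
move=> uv0 uv1; apply/colP => i.
by have [->|[->]] : i = 0 \/ i = 1; first
  by case: i => [[|[|//]] i2]; [left|right]; apply: val_inj.
Qed.

Lemma lift01 : lift ord0 ord0 = 1 :> 'I_2.
Proof. exact: val_inj. Qed.

Lemma bracketvv {R : comNzRingType} (u : 'cV[R]_2) : bracket u u = 0.
Proof. by rewrite /bracket; ring. Qed.

Lemma bracketv0 {R : comNzRingType} (u : 'cV[R]_2) : bracket u 0 = 0.
Proof. by rewrite /bracket !mxE !mulr0 subr0. Qed.

Lemma bracketC {R : comNzRingType} (u v : 'cV[R]_2) : bracket u v = - bracket v u.
Proof. by rewrite /bracket; ring. Qed.

Lemma bracket_dual_vec {R : comNzRingType} (a b c d : 'cV[R]_2) :
  bracket (dual_vec a b) (dual_vec c d) =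
  (bracket a c, bracket a d + bracket b c) :> dual R.
Proof.
by rewrite /bracket !mxE; congr (_, _); rewrite /re /du /=; ring.
Qed.

Lemma dual_vec_eq0 {R : comNzRingType} (a b : 'cV[R]_2) :
  dual_vec a b = 0 -> a = 0 /\ b = 0.
Proof.
move=> ab0; have ab i : (a i 0, b i 0) = (0, 0).
  by have /colP /(_ i) := ab0; rewrite !mxE.
by split; apply/colP => i; rewrite mxE; case: (ab i).
Qed.

(** A frame of bracket 1 expresses any vector as [w = (e, w) f - (f, w) e].  The
    ring is arbitrary because the frame of interest is the moving frame of a
    curve over the dual numbers, where there are zero divisors. *)
Lemma bracket_eq0 {R : comNzRingType} (e f w : 'cV[R]_2) :
  bracket e f = 1 -> bracket e w = 0 -> bracket f w = 0 -> w = 0.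
Proof.
move=> ef ew fw.
have wE : w = bracket e w *: f - bracket f w *: e.
  rewrite -[LHS]scale1r -ef.
  by apply: eq_col2; rewrite !mxE /bracket; ring.
by rewrite wE ew fw !scale0r subr0.
Qed.

(** The adjugate of the matrix with columns [e] and [f]; when [(e, f) = 1] it is
    the inverse, so it sends [e] to [(1, 0)] and [f] to [(0, 1)]. *)
Definition frame_matrix {R : comNzRingType} (e f : 'cV[R]_2) : 'M[R]_2 :=
  \matrix_(i, j) (if i == 0 then (if j == 0 then f 1 0 else - f 0 0)
                  else (if j == 0 then - e 1 0 else e 0 0)).

Lemma det_frame_matrix {R : comNzRingType} (e f : 'cV[R]_2) :
  \det (frame_matrix e f) = bracket e f.
Proof.
rewrite (expand_det_row _ 0) !big_ord_recl big_ord0 /cofactor !det_mx11.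
by rewrite !mxE /bracket /=; ring.
Qed.

Lemma frame_matrixE {R : comNzRingType} (e f w : 'cV[R]_2) :
  frame_matrix e f *m w = pt (bracket w f) (bracket e w).
Proof.
by apply: eq_col2; rewrite !mxE !big_ord_recl big_ord0 !mxE lift01 /bracket /=; ring.
Qed.

Lemma mulmx_quadratic {R : realType} (m n : nat) (A : 'M[R]_(m, n))
    (v0 v1 v2 : 'cV[R]_n) (s : R) :
  A *m quadratic v0 v1 v2 s = quadratic (A *m v0) (A *m v1) (A *m v2) s.
Proof. by rewrite /quadratic !mulmxDr -!scalemxAr. Qed.

Lemma bracket_quadratic {R : realType} (u1 u2 v2 : 'cV[R]_2) (s : R) :
  bracket (quadratic u1 u2 0 s) (quadratic v2 0 0 s) =
  bracket u1 v2 + s * bracket u2 v2.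
Proof. by rewrite /bracket /quadratic !mxE; ring. Qed.

Lemma affine_actE {R : realType} (A : 'M[R]_2) (b : 'cV[R]_2) gamma s :
  (real_part (affine_act A b gamma s) = A *m real_part (gamma s) + b) *
  (dual_part (affine_act A b gamma s) = A *m dual_part (gamma s)).
Proof. by split; apply/matrixP => i j; rewrite !mxE. Qed.

(** * Curves parametrized by equiaffine arc-length *)

Section FlatCurves.
Context {R : realType} {I : set R}.
Context (I_itv : is_interval I).
Context (I_nondeg : exists a b : R, [/\ I a, I b & a < b]).

Lemma equiaffine_arclengthP (gamma : R -> 'cV[dual R]_2) :
  equiaffine_arclength I gamma -> forall s, I s ->
  let alpha n := derive_in_n I n (real_part \o gamma) s in
  let beta n := derive_in_n I n (dual_part \o gamma) s in
  bracket (alpha 1%N) (alpha 2%N) = 1 /\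
  bracket (alpha 1%N) (beta 2%N) + bracket (beta 1%N) (alpha 2%N) = 0.
Proof. by move=> arc s /arc; rewrite bracket_dual_vec => -[]. Qed.

(** Differentiating [(gamma', gamma'') = 1] gives
    [(gamma'', gamma'') + (gamma', gamma''') = 0], whose first term vanishes.
    The computation is made separately for the real and dual parts, since the
    derivatives are taken in the real plane. *)
Lemma bracket_derive13_eq0 (gamma : R -> 'cV[dual R]_2) (s : R) :
  smooth_curve I gamma -> equiaffine_arclength I gamma -> I s ->
  bracket (curve_derive I 1 gamma s) (curve_derive I 3 gamma s) = 0.
Proof.
move=> [sa sb] /equiaffine_arclengthP arc Is.
have da n := smooth_in_has_derivative _ n s sa Is.
have db n := smooth_in_has_derivative _ n s sb Is.
have := has_derivative_in_bracket _ _ _ _ _ (da 1%N) (da 2%N).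
move=> /(has_derivative_in_cst_eq0 I_itv I_nondeg _ _ _ _ (fun t It => (arc t It).1) Is).
have := has_derivative_inD _ _ _ _ _
  (has_derivative_in_bracket _ _ _ _ _ (da 1%N) (db 2%N))
  (has_derivative_in_bracket _ _ _ _ _ (db 1%N) (da 2%N)).
move=> /(has_derivative_in_cst_eq0 I_itv I_nondeg _ _ _ _ (fun t It => (arc t It).2) Is).
rewrite /curve_derive bracket_dual_vec.
move: (derive_in_n I 1 (real_part \o gamma) s)
  (derive_in_n I 2 (real_part \o gamma) s)
  (derive_in_n I 3 (real_part \o gamma) s) => a1 a2 a3.
move: (derive_in_n I 1 (dual_part \o gamma) s)
  (derive_in_n I 2 (dual_part \o gamma) s)
  (derive_in_n I 3 (dual_part \o gamma) s) => b1 b2 b3 du0 re0; congr (_, _).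
  by rewrite -re0 bracketvv add0r.
have b22 : bracket a2 b2 + bracket b2 a2 = 0 by rewrite (bracketC b2) subrr.
by move: du0; rewrite addrACA b22 add0r.
Qed.

Lemma curve_derive3_eq0 (gamma : R -> 'cV[dual R]_2) :
  smooth_curve I gamma -> equiaffine_arclength I gamma ->
  (forall s, I s -> equiaffine_curvature I gamma s = 0) ->
  forall s, I s -> curve_derive I 3 gamma s = 0.
Proof.
move=> smooth arc curv0 s Is.
apply: (bracket_eq0 _ _ _ (arc s Is) _ (curv0 s Is)).
exact: bracket_derive13_eq0.
Qed.

End FlatCurves.

Theorem corollary3p7 (R : realType) (I : set R)
    (I_itv : is_interval I) (I_nondeg : exists a b : R, [/\ I a, I b & a < b])
    (gamma : R -> 'cV[dual R]_2)
    (gamma_smooth : smooth_curve I gamma)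
    (gamma_arclength : equiaffine_arclength I gamma) :
  (forall s, I s -> equiaffine_curvature I gamma s = 0) <->
  (exists (A : 'M[R]_2) (b : 'cV[R]_2), \det A = 1 /\
    exists (c0 c1 c2 : R) (beta0 : 'cV[R]_2), forall s, I s ->
      real_part (affine_act A b gamma s) = pt s (s ^+ 2 / 2) /\
      dual_part (affine_act A b gamma s) =
        pt (c0 * s ^+ 2 + c1 * s) (- (c1 / 2) * s ^+ 2 + c2 * s) + beta0).
Proof.
split=> [curv0|[A [b [detA [c0 [c1 [c2 [beta0 normal]]]]]]] s Is].
- have g3 s (Is : I s) : derive_in_n I 3 (real_part \o gamma) s = 0 /\
      derive_in_n I 3 (dual_part \o gamma) s = 0.
    exact/dual_vec_eq0/(curve_derive3_eq0 I_itv I_nondeg _ gamma_smooth).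
  have [sa sb] := gamma_smooth.
  have [a0 [a1 [a2 aq]]] := quadratic_of_derive_in3 I_itv I_nondeg _ _ sa
    (fun s Is => (g3 s Is).1).
  have [b0 [b1 [b2 bq]]] := quadratic_of_derive_in3 I_itv I_nondeg _ _ sb
    (fun s Is => (g3 s Is).2).
  have [a12 arc_du] : bracket a1 a2 = 1 /\ bracket a1 b2 = - bracket b1 a2.
    have [x0 [_ [Ix0 _ _]]] := I_nondeg.
    have [adq1 adq2 _] := derive_in_n_quadratic I_itv I_nondeg _ _ _ _ aq.
    have [bdq1 bdq2 _] := derive_in_n_quadratic I_itv I_nondeg _ _ _ _ bq.
    have [] := equiaffine_arclengthP _ gamma_arclength x0 Ix0.
    rewrite adq1 ?inE // adq2 ?inE // bdq1 ?inE // bdq2 ?inE //.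
    rewrite !bracket_quadratic bracketvv mulr0 addr0 => a12 arc_du; split=> //.
    by apply/eqP; rewrite -addr_eq0 -[X in _ == X]arc_du (bracketC b2); apply/eqP; ring.
  (* [frame_matrix a1 a2] straightens the frame, the translation moves the image
     of [a0] to the origin, and the constants are read off from
     [frame_matrixE] applied to [b1] and [b2]. *)
  exists (frame_matrix a1 a2), (- (frame_matrix a1 a2 *m a0)).
  split; first by rewrite det_frame_matrix.
  exists (bracket b2 a2 / 2), (bracket b1 a2), (bracket a1 b1),
    (frame_matrix a1 a2 *m b0).
  move=> s Is; rewrite !affine_actE.
  rewrite -[real_part _]/((real_part \o gamma) s).
  rewrite -[dual_part _]/((dual_part \o gamma) s).
  rewrite aq ?inE // bq ?inE // !mulmx_quadratic.
  rewrite (frame_matrixE _ _ a1) (frame_matrixE _ _ a2).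
  rewrite (frame_matrixE _ _ b1) (frame_matrixE _ _ b2).
  rewrite !bracketvv a12 arc_du /quadratic.
  by split; apply: eq_col2; rewrite !mxE /=; field.
(* Undoing the affine map, both parts of [gamma] are quadratic on [I], so the
   third derivatives vanish. *)
- have uA : A \in unitmx by rewrite unitmxE detA unitr1.
  have aq : {in I, real_part \o gamma =1 quadratic (invmx A *m - b)
      (invmx A *m pt 1 0) (invmx A *m pt 0 1)}.
    move=> t; rewrite inE => /normal[+ _]; rewrite affine_actE => At.
    rewrite -mulmx_quadratic -[LHS](mulKmx uA); congr (_ *m _).
    rewrite -[LHS](addrK b) At /quadratic.
    by apply: eq_col2; rewrite !mxE /=; ring.
  have bq : {in I, dual_part \o gamma =1 quadratic (invmx A *m beta0)
      (invmx A *m pt c1 c2) (invmx A *m pt (2 * c0) (- c1))}.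
    move=> t; rewrite inE => /normal[_ +]; rewrite affine_actE => At.
    rewrite -mulmx_quadratic -[LHS](mulKmx uA); congr (_ *m _).
    rewrite At /quadratic.
    by apply: eq_col2; rewrite !mxE /=; field.
  have [_ _ a3] := derive_in_n_quadratic I_itv I_nondeg _ _ _ _ aq.
  have [_ _ b3] := derive_in_n_quadratic I_itv I_nondeg _ _ _ _ bq.
  rewrite /equiaffine_curvature /curve_derive a3 ?inE // b3 ?inE // bracket_dual_vec.
  move: (derive_in_n I 2 _ s) (derive_in_n I 2 _ s) => a2 b2.
  by rewrite !bracketv0 addr0.
Qed.
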